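(* Let $L$ be a closed-term language and $L'$ a language (value set $\mathbf V'$) satisfying the Alpha Postulate. Let $T$ be a compositional translation from $L$ into $L'$ that is valid up to an equivalence relation $\sim$. Let $\approx$ be any congruence for $L'$ with $\equiv^\alpha_{L'}\subseteq\,\approx\,\subseteq\,\sim$. Then $T$ is correct up to an equivalence relation $\approx_T$ on $\mathbf V\cup\mathbf V'$ (where $\mathbf V$ is the value set of $L$), contained in $\sim$, whose restriction to $\mathbf V'$ coincides with $\approx$.
   Context: Fix a sufficiently large set $\mathcal V$ of variables. A language $L$ has a set $\mathbb T_L$ of expressions built inductively from variables by operators and possibly other (possibly binding) constructs; $\mathrm{fv}(E)$ denotes free variables, and closed terms are expressions with no free variables. Semantics: $[\![\cdot]\!]_L:\mathbb T_L\to((\mathcal V\to\mathbf V)\to\mathbf V)$ with $[\![X]\!]_L(\rho)=\rho(X)$, $[\![E]\!]_L(\rho)$ depending only on $\rho|_{\mathrm{fv}(E)}$, and (standing assumption) for all $E$, substitutions $\sigma$ and valuations $\rho$ there is $F=_\alpha E$ with $[\![E[\sigma]]\!]_L(\rho)=[\![F]\!]_L([\![\sigma]\!]_L(\rho))$, where $[\![\sigma]\!]_L(\rho)(X)=[\![\sigma(X)]\!]_L(\rho)$. Substitutions $\sigma:\mathcal V\rightharpoonup\mathbb T_L$ act by capture-avoiding replacement $E[\sigma]$; $=_\alpha$ is $\alpha$-convertibility. A closed-term language is one whose value set $\mathbf V$ is the set of closed terms of $L$, so valuations are closed substitutions, and $[\![E]\!]_L(\rho)=E[\rho]$. $v\equiv^\alpha_{L'}w$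 iff there are $E=_\alpha F$ in $\mathbb T_{L'}$ and a valuation $\zeta$ with $[\![E]\!]_{L'}(\zeta)=v$, $[\![F]\!]_{L'}(\zeta)=w$; the Alpha Postulate for $L'$ says $\equiv^\alpha_{L'}$ is an equivalence. A translation is a map $T:\mathbb T_L\to\mathbb T_{L'}$; it is compositional if $T(E[\sigma])=_\alpha T(E)[T\circ\sigma]$ for all $E$ and $\sigma:\mathrm{fv}(E)\to\mathbb T_L$, $E=_\alpha F$ implies $T(E)=_\alpha T(F)$, and $T(X)=X$ for $X\in\mathcal V$. A semantic translation is $R\subseteq\mathbf V'\times\mathbf V$ such that every $v\in\mathbf V$ has some $v'Rv$; $T$ is correct w.r.t. $R$ if $[\![T(E)]\!]_{L'}(\eta)\,R\,[\![E]\!]_L(\rho)$ whenever $\eta(X)R\rho(X)$ for all $X$. $T$ is valid up to $\sim$ if correct w.r.t. some semantic translation $R\subseteq\,\sim$, and correct up to an equivalence $\approx_T$ if the restriction of $\approx_T$ to $\mathbf V'\times\mathbf V$ is a semantic translation and $T$ is correct w.r.t. it. An equivalence $\approx$ on $\mathbf V'$ is a congruence for $L'$ if $[\![E]\!]_{L'}(\nu)\approx[\![E]\!]_{L'}(\rho)$ for all $E\in\mathbb T_{L'}$ whenever $\nu(X)\approx\rho(X)$ for all $X$.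
   Formalization: Compositionality is required for all σ defined at least on fv(E), so T(E) has no free variables beyond those of E (with domain exactly fv(E) the claim is false), and V ∪ V' is taken as a disjoint union (with overlapping value sets the claim can fail). *)

(* Defs.v *)
From Stdlib Require Export Relations RelationClasses.
From Stdlib Require Import ProofIrrelevance.

Set Implicit Arguments.
Unset Strict Implicit.

(* A substitution is a partial function from variables to expressions;
   outside its domain it leaves variables unchanged. *)
Definition psubst (var expr : Type) := var -> option expr.

Definition papply (var expr : Type) (inj : var -> expr)
    (sigma : psubst var expr) (X : var) : expr :=
  match sigma X with Some E => E | None => inj X end.

(* The syntactic half of a language.  The theory does not fix the operators
   and binders from which expressions are built, so neither does this record:
   it keeps only facts valid for free variables, capture-avoiding substitution
   and alpha-convertibility in any syntax with binding.  Capture-avoidance is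
   what makes [fv_subst] an equivalence. *)
Record syntax (var : Type) := Syntax {
  expr : Type;
  evar : var -> expr;
  fv : expr -> var -> Prop;
  subst : expr -> psubst var expr -> expr;
  alpha : relation expr;
  fv_evar : forall X Y, fv (evar X) Y <-> Y = X;
  subst_evar : forall X sigma, subst (evar X) sigma = papply evar sigma X;
  subst_local : forall E sigma tau,
    (forall X, fv E X -> sigma X = tau X) -> subst E sigma = subst E tau;
  subst_fresh : forall E sigma,
    (forall X, fv E X -> sigma X = None) -> subst E sigma = E;
  fv_subst : forall E sigma Y,
    fv (subst E sigma) Y <-> exists2 X, fv E X & fv (papply evar sigma X) Y;
  alpha_equiv : Equivalence alpha;
  alpha_fv : forall E F, alpha E F -> forall X, fv E X <-> fv F X;
  alpha_subst : forall E F sigma,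
    alpha E F -> alpha (subst E sigma) (subst F sigma)
}.

Arguments expr {var} s.
Arguments evar {var} s X.
Arguments fv {var s} E X.
Arguments subst {var s} E sigma.
Arguments alpha {var} s E F.

(* Unlike [papply], stated for a given syntax: sigma(X), read as X when X is
   outside the domain. *)
Definition app {var : Type} {S : syntax var} (sigma : psubst var (expr S))
    (X : var) : expr S :=
  papply (evar S) sigma X.

Definition closed {var : Type} {S : syntax var} (E : expr S) : Prop :=
  forall X, ~ fv E X.

(* [sem_subst] is a standing assumption on all languages. *)
Record language (var : Type) := Language {
  syn :> syntax var;
  value : Type;
  sem : expr syn -> (var -> value) -> value;
  sem_evar : forall X rho, sem (evar syn X) rho = rho X;
  sem_fv : forall E nu rho,
    (forall X, fv E X -> nu X = rho X) -> sem E nu = sem E rho;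
  sem_subst : forall E sigma rho, exists F,
    alpha syn F E /\
    sem (subst E sigma) rho = sem F (fun X => sem (app sigma X) rho)
}.

Arguments value {var} l.
Arguments sem {var l} E rho.

Definition closed_term (var : Type) (S : syntax var) : Type :=
  { E : expr S | closed E }.

Definition total_psubst {var : Type} {S : syntax var}
    (rho : var -> closed_term S) : psubst var (expr S) :=
  fun X => Some (proj1_sig (rho X)).

Lemma closed_subst (var : Type) (S : syntax var) (E : expr S)
    (rho : var -> closed_term S) : closed (subst E (total_psubst rho)).
Proof.
intros Y H; apply fv_subst in H; destruct H as [X _ HY].
exact (proj2_sig (rho X) Y HY).
Qed.

Definition closed_sem {var : Type} {S : syntax var} (E : expr S)
    (rho : var -> closed_term S) : closed_term S :=
  exist _ (subst E (total_psubst rho)) (@closed_subst var S E rho).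

Lemma closed_term_eq (var : Type) (S : syntax var) (p q : closed_term S) :
  proj1_sig p = proj1_sig q -> p = q.
Proof.
destruct p as [p hp], q as [q hq]; simpl; intros <-.
f_equal; apply proof_irrelevance.
Qed.

(* Value set and semantics of a closed-term language are determined by its
   syntax; only the standing assumption remains to be required. *)
Record closed_term_language (var : Type) := ClosedTermLanguage {
  ct_syn : syntax var;
  ct_subst : forall (E : expr ct_syn) sigma rho, exists F,
    alpha ct_syn F E /\
    closed_sem (subst E sigma) rho =
      closed_sem F (fun X => closed_sem (app sigma X) rho)
}.

Lemma closed_sem_evar (var : Type) (S : syntax var) (X : var)
    (rho : var -> closed_term S) : closed_sem (evar S X) rho = rho X.
Proof. apply closed_term_eq; simpl; now rewrite subst_evar. Qed.

Lemma closed_sem_fv (var : Type) (S : syntax var) (E : expr S)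
    (nu rho : var -> closed_term S) :
  (forall X, fv E X -> nu X = rho X) -> closed_sem E nu = closed_sem E rho.
Proof.
intros H; apply closed_term_eq; simpl; apply subst_local.
intros X HX; unfold total_psubst; now rewrite H.
Qed.

Definition ct_language (var : Type) (L : closed_term_language var) :
    language var :=
  {| syn := ct_syn L;
     value := closed_term (ct_syn L);
     sem := @closed_sem var (ct_syn L);
     sem_evar := @closed_sem_evar var (ct_syn L);
     sem_fv := @closed_sem_fv var (ct_syn L);
     sem_subst := @ct_subst var L |}.

Coercion ct_language : closed_term_language >-> language.

Definition alpha_val {var : Type} (L : language var) (v w : value L) : Prop :=
  exists (E F : expr L) (zeta : var -> value L),
    alpha L E F /\ sem E zeta = v /\ sem F zeta = w.

Definition alpha_postulate {var : Type} (L : language var) : Prop :=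
  Equivalence (@alpha_val var L).

Definition congruence {var : Type} (L : language var)
    (approx : relation (value L)) : Prop :=
  Equivalence approx /\
  forall (E : expr L) (nu rho : var -> value L),
    (forall X, approx (nu X) (rho X)) -> approx (sem E nu) (sem E rho).

Section Translations.
Context {var : Type} {L L' : language var}.

Definition translation := expr L -> expr L'.

Definition comp_psubst (T : translation) (sigma : psubst var (expr L)) :
    psubst var (expr L') :=
  fun X => option_map T (sigma X).

(* "sigma : fv(E) -> expr" is read as: sigma is defined on (at least) fv(E).
   Extra variables in the domain do not affect E[sigma], so the first clause
   also prevents T(E) from having free variables that E does not have.  Were
   the domain required to be exactly fv(E), such variables would be allowed,
   and a translation valid up to ~ might not be correct up to any equivalence
   extending a finer congruence. *)
Definition compositional (T : translation) : Prop :=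
  (forall (E : expr L) (sigma : psubst var (expr L)),
     (forall X, fv E X -> sigma X <> None) ->
     alpha L' (T (subst E sigma)) (subst (T E) (comp_psubst T sigma))) /\
  (forall E F : expr L, alpha L E F -> alpha L' (T E) (T F)) /\
  (forall X : var, T (evar L X) = evar L' X).

Definition semantic_translation (R : value L' -> value L -> Prop) : Prop :=
  forall v : value L, exists v' : value L', R v' v.

Definition correct_wrt (T : translation) (R : value L' -> value L -> Prop) :
    Prop :=
  forall (E : expr L) (eta : var -> value L') (rho : var -> value L),
    (forall X, R (eta X) (rho X)) -> R (sem (T E) eta) (sem E rho).

(* Relations on the union of the two value sets are relations on their
   disjoint union. *)
Definition restriction (sim : relation (value L + value L')) :
    value L' -> value L -> Prop :=
  fun v' v => sim (inr v') (inl v).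

Definition valid_up_to (T : translation)
    (sim : relation (value L + value L')) : Prop :=
  exists R : value L' -> value L -> Prop,
    semantic_translation R /\
    (forall v' v, R v' v -> restriction sim v' v) /\
    correct_wrt T R.

Definition correct_up_to (T : translation)
    (approx : relation (value L + value L')) : Prop :=
  semantic_translation (restriction approx) /\
  correct_wrt T (restriction approx).

End Translations.

Arguments translation {var} L L'.

(* Main.v *)
(* Evaluate translated closed terms in one fixed valuation eta0 of L' that is
   constantly a value v0' related to a value v0 of L: f(p) = [[T(p)]](eta0).
   Validity of T, applied to eta0 and the constant valuation v0, puts f(p) in
   the ~-class of p.  Define approx_T by identifying p with f(p) and comparing
   by approx.  Since E[rho] is a substitution instance of E, compositionality
   gives [[T(E[rho])]](eta0) = [[T(E)]](f o rho) up to alpha-conversion, hence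
   up to approx, and correctness follows from the congruence property. *)

Require Import Defs.
From Stdlib Require Import Classical.

Lemma closed_sem_closed_term (var : Type) (S : syntax var)
    (p : closed_term S) (rho : var -> closed_term S) :
  closed_sem (proj1_sig p) rho = p.
Proof.
apply closed_term_eq; simpl.
rewrite (@subst_local _ S _ _ (fun _ => None)).
- now apply subst_fresh.
- intros X HX; destruct (proj2_sig p X HX).
Qed.

Lemma alpha_val_sem {var : Type} (L : language var) (E F : expr L)
    (zeta : var -> value L) :
  alpha L E F -> alpha_val (sem E zeta) (sem F zeta).
Proof. intros H; now exists E, F, zeta. Qed.

(** Two alpha-conversions intervene, one from compositionality and one from the semantics of
    substitution in [L']; [approx] absorbs both. *)
Lemma sem_translate_instance (var : Type)
    (L : closed_term_language var) (L' : language var) (T : translation L L')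
    (approx : relation (value L')) :
  compositional T ->
  Equivalence approx ->
  (forall v w : value L', alpha_val v w -> approx v w) ->
  forall (E : expr L) (rho : var -> value L) (eta : var -> value L'),
    approx (sem (T (proj1_sig (sem E rho))) eta)
           (sem (T E) (fun X => sem (T (proj1_sig (rho X))) eta)).
Proof.
intros [Tsubst _] approx_equiv alpha_approx E rho eta.
pose (tau := comp_psubst (L := L) T (total_psubst rho)).
transitivity (sem (subst (T E) tau) eta).
(* [sem E rho] is by definition an instance of [E] under a substitution defined everywhere. *)
- apply alpha_approx, alpha_val_sem, Tsubst; discriminate.
- destruct (@sem_subst _ L' (T E) tau eta) as [F [FE ->]].
  exact (alpha_approx _ _ (alpha_val_sem _ _ _ _ FE)).
Qed.

Lemma valid_closed_term_evaluation (var : Type)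
    (L : closed_term_language var) (L' : language var) (T : translation L L')
    (sim : relation (value L + value L')) :
  valid_up_to T sim -> inhabited (value L) ->
  exists eta : var -> value L', forall p : value L,
    sim (inr (sem (T (proj1_sig p)) eta)) (inl p).
Proof.
intros [R [Rtotal [Rsim Rcorrect]]] [v0].
destruct (Rtotal v0) as [v0' Rv0].
exists (fun _ => v0'); intros p; apply Rsim.
(* A closed term is its own value, so correctness applies to [p] read as an expression. *)
rewrite <- (closed_sem_closed_term var (ct_syn L) p (fun _ => v0)) at 2.
exact (Rcorrect _ _ (fun _ => v0) (fun _ => Rv0)).
Qed.

Lemma correct_evaluation (var : Type)
    (L : closed_term_language var) (L' : language var) (T : translation L L')
    (sim : relation (value L + value L')) (approx : relation (value L')) :
  compositional T ->
  valid_up_to T sim ->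
  congruence approx ->
  (forall v w : value L', alpha_val v w -> approx v w) ->
  exists f : value L -> value L',
    (forall p, sim (inr (f p)) (inl p)) /\
    (forall E eta rho, (forall X, approx (eta X) (f (rho X))) ->
       approx (sem (T E) eta) (f (sem E rho))).
Proof.
intros Tcomp Tvalid [approx_equiv approx_congr] alpha_approx.
(* Without closed terms there is no [v0] to build [eta0] from; [f] is then the empty function. *)
destruct (classic (inhabited (value L))) as [V_inh | V_empty].
- destruct (valid_closed_term_evaluation _ _ _ _ _ Tvalid V_inh)
    as [eta0 eta0_sim].
  exists (fun p => sem (T (proj1_sig p)) eta0); split; [exact eta0_sim |].
  intros E eta rho Heta.
  transitivity (sem (T E) (fun X => sem (T (proj1_sig (rho X))) eta0)).
  + now apply approx_congr.
  + symmetry.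
    exact (sem_translate_instance _ _ _ _ _ Tcomp approx_equiv alpha_approx
             E rho eta0).
- exists (fun p => False_rect _ (V_empty (inhabits p))); split.
  + intros p; destruct (V_empty (inhabits p)).
  + intros E eta rho _; destruct (V_empty (inhabits (sem E rho))).
Qed.

Theorem theorem6 (var : Type)
    (L : closed_term_language var) (L' : language var)
    (T : translation L L')
    (sim : relation (value L + value L')) (approx : relation (value L')) :
  alpha_postulate L' ->
  compositional T ->
  Equivalence sim ->
  valid_up_to T sim ->
  congruence approx ->
  (forall v w : value L', alpha_val v w -> approx v w) ->
  (forall v w : value L', approx v w -> sim (inr v) (inr w)) ->
  exists approxT : relation (value L + value L'),
    Equivalence approxT /\
    (forall x y, approxT x y -> sim x y) /\
    (forall v w : value L', approxT (inr v) (inr w) <-> approx v w) /\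
    correct_up_to T approxT.
Proof.
intros _ Tcomp sim_equiv Tvalid approx_cong alpha_approx approx_sim.
destruct (correct_evaluation _ _ _ _ _ _ Tcomp Tvalid approx_cong alpha_approx)
  as [f [f_sim f_correct]].
destruct approx_cong as [approx_equiv _].
(* [g] retracts the union onto the values of [L']; the relation sought is the pullback of [approx]
   along [g]. *)
pose (g x := match x with inl p => f p | inr v => v end).
assert (g_sim : forall x, sim (inr (g x)) x).
{ intros [p | v]; [apply f_sim | reflexivity]. }
exists (fun x y => approx (g x) (g y)).
split; [| split; [| split; [| split]]].
- split.
  + intros x; reflexivity.
  + intros x y Hxy; now symmetry.
  + intros x y z Hxy Hyz; now transitivity (g y).
(* Chain [x ~ g x ~ g y ~ y], with [approx_sim] in the middle. *)
- intros x y Hxy.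
  transitivity (inr (A := value L) (g x)); [symmetry; apply g_sim |].
  transitivity (inr (A := value L) (g y)); [now apply approx_sim | apply g_sim].
- intros v w; reflexivity.
- intros p; exists (f p); unfold restriction; simpl; reflexivity.
(* Restricted to pairs [v'], [v], the pullback unfolds to [approx v' (f v)]. *)
- exact f_correct.
Qed.
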